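(* Let $\Gamma_0\subset\Gamma$ be countable groups and let $\Gamma_0\curvearrowright(X,\mu)$ be a probability measure preserving action on an atomless standard probability space which has the property (T) relative to the space. Then the co-induced action $\Gamma\curvearrowright(Y,\eta)$ has the property (T) relative to the space if and only if $[\Gamma:\Gamma_0]<\infty$.
   Context: Co-induced action: let $D\subset\Gamma$ be a fundamental domain for the right multiplication action of $\Gamma_0$ on $\Gamma$ (a set of representatives of the left cosets $d\Gamma_0$). For $\gamma\in\Gamma$, $d\in D$, define $\gamma. d\in D$ and $\sigma(\gamma,d)\in\Gamma_0$ by $\gamma d=(\gamma. d)\,\sigma(\gamma,d)$. Set $(Y,\eta)=(\prod_D X,\bigotimes_D\mu)$; the co-induced action of $\Gamma$ on $(Y,\eta)$ is $\gamma (x_d)_{d\in D}=(\sigma(\gamma^{-1},d)^{-1}x_{\gamma^{-1}. d})_{d\in D}$. A probability measure preserving action $\Gamma\curvearrowright(X,\mu)$ of a countable group $\Gamma$ on a standard probability space has the property (T) relative to the space (is rigid) if for every sequence $(\nu_n)$ of Borel probability measures on $X\times X$ satisfying (1) $p^i_*\nu_n=\mu$ for all $n$ and $i=1,2$, where $p^i:X\times X\to X$ is the projection onto the $i$-th coordinate; (2) $\int_{X\times X}\varphi(x)\psi(y)\,d\nu_n(x,y)\to\int_X\varphi(x)\psi(x)\,d\mu(x)$ as $n\to\infty$ for all bounded Borel functions $\varphi,\psi:X\to\mathbb{C}$; (3) $\|(\gamma\times\gamma)_*\nu_n-\nu_n\|\to 0$ as $n\to\infty$ (total variation norm) for every $\gamma\in\Gamma$;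 one has $\nu_n(\Delta_X)\to 1$, where $\Delta_X=\{(x,x):x\in X\}$. *)

(* Defs.v *)
From HB Require Import structures.
From mathcomp Require Import all_boot all_order all_algebra.
From mathcomp.real_closed Require Import complex.
From mathcomp Require Import all_classical all_reals all_analysis.

Set Implicit Arguments.
Unset Strict Implicit.
Unset Printing Implicit Defensive.

Import Order.TTheory GRing.Theory Num.Theory.
Import numFieldNormedType.Exports.

Local Open Scope classical_set_scope.
Local Open Scope ring_scope.
Local Open Scope complex_scope.

Section StandardSpaces.
Context {R : realType}.

Definition polish (M : metricType R) : Prop :=
  (forall F : set_system M, ProperFilter F -> cauchy F ->
     exists x : M, F --> x) /\
  (exists2 S : set M, countable S & dense S).

(* The bijection f identifies the sigma-algebra of X with the Borel
   sigma-algebra of M. *)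
Definition standard_borel d (X : measurableType d) : Prop :=
  exists (M : metricType R) (f : X -> M),
    [/\ polish M, bijective f &
        (measurable : set (set X)) = [set f @^-1` B | B in <<s @open M >>]].

Definition atomless d (X : measurableType d) (mu : probability X R) : Prop :=
  forall A, measurable A -> (0 < mu A)%E ->
    exists B, [/\ measurable B, B `<=` A, (0 < mu B)%E & (mu B < mu A)%E].

End StandardSpaces.

Section ComplexFunctions.
Context {R : realType} d (X : measurableType d).

(* The topology on R[i] is the one induced by the modulus, carried by the
   alias R[i]^o. *)
Definition bounded_borel (f : X -> R[i]) : Prop :=
  measurable_fun setT (f : X -> g_sigma_algebraType (@open R[i]^o)) /\
  (exists M : R[i], forall x, `|f x| <= M).

Definition cintegral (mu : probability X R) (f : X -> R[i]) : R[i] :=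
  (\int[mu]_x complex.Re (f x))%R +i* (\int[mu]_x complex.Im (f x))%R.

End ComplexFunctions.

(* Total variation norm |rho|(T) of a signed measure rho. *)
Definition tv_norm {R : realType} d (T : measurableType d)
    (rho : set T -> \bar R) : \bar R :=
  ereal_sup [set v | exists (n : nat) (A : nat -> set T),
    [/\ forall i, measurable (A i), trivIset setT A &
        v = (\sum_(i < n) `|rho (A i)|)%E]].

Section Actions.
Context {R : realType} d (X : measurableType d) (mu : probability X R).
Context {G : groupType} (act : G -> X -> X).

Definition pmp_action : Prop :=
  [/\ forall x, act 1%g x = x,
      forall g h x, act (g * h)%g x = act g (act h x),
      forall g, measurable_fun setT (act g) &
      forall g A, measurable A -> pushforward mu (act g) A = mu A].

Definition rigid : Prop :=
  forall nu : nat -> probability (X * X)%type R,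
    (forall n A, measurable A ->
       pushforward (nu n) fst A = mu A /\ pushforward (nu n) snd A = mu A) ->
    (forall phi psi : X -> R[i], bounded_borel phi -> bounded_borel psi ->
       (fun n => cintegral (nu n) (fun z => phi z.1 * psi z.2) : R[i]^o)
         @ \oo --> (cintegral mu (fun x => phi x * psi x) : R[i]^o)) ->
    (forall g,
       (fun n => tv_norm (fun A : set (X * X) =>
          pushforward (nu n) (fun z : X * X => (act g z.1, act g z.2)) A
            - nu n A)%E) @ \oo --> 0%E) ->
    (fun n => nu n [set z | z.1 = z.2]) @ \oo --> 1%E.

End Actions.

Section ProductSpace.
Context (I : Type) d (X : measurableType d).

Definition coordinate_sets : set (set (I -> X)) :=
  [set C | exists (i : I) (A : set X),
     measurable A /\ C = [set x | A (x i)]].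

Definition power_space : Type := I -> X.

HB.instance Definition _ :=
  Measurable.copy power_space (g_sigma_algebraType coordinate_sets).

(* eta is the measure \bigotimes_I mu, determined by its values on the
   finite-dimensional boxes. *)
Definition is_product_measure {R : realType} (mu : probability X R)
    (eta : probability power_space R) : Prop :=
  forall (n : nat) (i : 'I_n -> I) (A : 'I_n -> set X), injective i ->
    (forall k, measurable (A k)) ->
    eta [set x | forall k, A k (x (i k))] = (\prod_(k < n) mu (A k))%E.

End ProductSpace.

Arguments coordinate_sets I {d} X.

Section CoInduced.
Context {G : groupType} {S : pred G} (G0 : subGroupType S).

Definition left_coset (g : G) : set G := [set (g * val s)%g | s in [set: G0]].

Definition finite_index : Prop := finite_set (range left_coset).

Definition fundamental_domain (D : set G) : Prop :=
  forall g, exists! d, D d /\ left_coset g d.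

Context (D : set G).

(* The pair (g . d, sigma(g, d)); it is the unique one with
   g d = (g . d) sigma(g, d) when D is a fundamental domain, and the default
   value (d, 1) of xget is then never used. *)
Definition decomp (g : G) (d : D) : D * G0 :=
  xget (d, 1%g) [set p : D * G0 | (g * val d = val p.1 * val p.2)%g].

Definition dom_act (g : G) (d : D) : D := (decomp g d).1.

Definition cocycle (g : G) (d : D) : G0 := (decomp g d).2.

Definition coinduced dX (X : measurableType dX) (act : G0 -> X -> X)
    (g : G) (x : power_space D X) : power_space D X :=
  fun d => act (cocycle g^-1%g d)^-1%g (x (dom_act g^-1%g d)).

End CoInduced.

(* Main.v *)
Require Import Defs.
From mathcomp Require Import all_boot all_order all_algebra.
From mathcomp.real_closed Require Import complex.
From mathcomp Require Import lra ring.
From mathcomp Require Import all_classical all_reals all_analysis.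
From mathcomp Require Import measurable_realfun.

Set Implicit Arguments.
Unset Strict Implicit.
Unset Printing Implicit Defensive.

Import Order.TTheory GRing.Theory Num.Theory.
Import numFieldNormedType.Exports.

Local Open Scope classical_set_scope.
Local Open Scope ring_scope.

(** Let Y be the power of X indexed by the fundamental domain D, whose
    cardinality is the index of Gamma0 in Gamma
    ([finite_index_fundamental_domain]).

    If D is finite, rigidity of the co-induced action is read off one
    coordinate at a time. The conjugate e Gamma0 e^-1 of Gamma0 fixes the
    coordinate e, and acts on it exactly as Gamma0 acts on X
    ([coinduced_stabilizer]). Hence a sequence nu_n on Y x Y as in the
    definition of rigidity projects, along the coordinate e, to such a sequence
    on X x X ([rigid_coord]): the projection maps the action of a conjugate to
    the action of Gamma0, and pushing forward decreases the total variation.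
    So the coordinates e of the two components agree with nu_n-probability
    tending to 1; the union bound over the finitely many e concludes
    ([rigid_coinduced_finite]).

    If D is infinite, the diagonal of Y is approximated by invariant measures
    that give it little mass. Let (z, x, x') have law eta x eta x eta, let
    C be a measurable subset of X, and let y be obtained from x by resampling:
    y_i = x'_i if z_i lies in C, and y_i = x_i otherwise. The law of (x, y) has
    both marginals equal to eta ([law_first], [law_mixed]). It is exactly
    invariant under Gamma, because Gamma acts on Y by permuting the coordinates
    and then acting on each of them by an element of Gamma0, and the selector z
    can be permuted along ([mixed_pair_invariant]). As mu has no atom, x and y
    agree on a resampled coordinate with probability 0, so that for any N
    coordinates the diagonal has mass at most (1 - mu C)^N, which is below 1/2
    for large N whenever mu C > 0 ([mixed_diagonal_le_half]).
    Finally let C_n have positive measure at most 2^-n. The measurable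
    sets B for which the events {x in B} and {y_n in B} differ with vanishing
    probability form a sigma-algebra, which contains the coordinate sets
    ([vanishing_discrepancy]); cutting a bounded function into level sets then
    gives the weak convergence to the diagonal measure
    ([cvg_integral_of_discrepancy]). This contradicts rigidity
    ([not_rigid_coinduced_infinite]).

    A standard Borel space has a countable family of measurable sets separating
    points ([standard_borel_separated]), which makes its points and the
    diagonals of X and of countable powers of X measurable. *)

(** * Image probabilities and power spaces *)

Section ImageProbability.
Context {R : realType} d d' (T : measurableType d) (T' : measurableType d').

Definition image_prob (P : probability T R) (f : T -> T')
    (mf : measurable_fun setT f) : probability T' R :=
  distribution P (mfun_Sub (mem_set mf)).

Lemma measurable_preimage (f : T -> T') (B : set T') :
  measurable_fun setT f -> measurable B -> measurable (f @^-1` B).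
Proof. by move=> mf mB; rewrite -[X in measurable X]setTI; exact: mf. Qed.

End ImageProbability.

Section ProductMap.
Context {R : realType} d1 d2 (T1 : measurableType d1) (T2 : measurableType d2).
Context (P1 : probability T1 R) (P2 : probability T2 R).

Lemma measurable_prod_map (f : T1 -> T1) (g : T2 -> T2) :
  measurable_fun setT f -> measurable_fun setT g ->
  measurable_fun setT (fun w : T1 * T2 => (f w.1, g w.2)).
Proof.
by move=> mf mg; apply: measurable_fun_pair;
  apply: measurableT_comp => //; exact: measurableT_comp.
Qed.

(** Both sides are measures which agree on rectangles. *)
Lemma product_map_preserves (f : T1 -> T1) (g : T2 -> T2) :
  measurable_fun setT f -> measurable_fun setT g ->
  (forall A, measurable A -> P1 (f @^-1` A) = P1 A) ->
  (forall A, measurable A -> P2 (g @^-1` A) = P2 A) ->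
  forall C, measurable C ->
    (P1 \x P2)%E ((fun w => (f w.1, g w.2)) @^-1` C) = (P1 \x P2)%E C.
Proof.
move=> mf mg Pf Pg C mC.
pose Q : probability _ R := (P1 \x P2)%E.
apply/esym; apply: (product_measure_unique
  (m' := image_prob Q (measurable_prod_map mf mg))) => // A B mA mB.
transitivity ((P1 \x P2)%E ((f @^-1` A) `*` (g @^-1` B))) => //.
rewrite product_measure1E//; [|exact: measurable_preimage..].
by congr (_ * _)%E; [exact: Pf|exact: Pg].
Qed.

End ProductMap.

Section Coordinates.
Context {I : Type} {d} {X : measurableType d}.
Local Notation Y := (power_space I X).

Lemma measurable_coord (i : I) : measurable_fun setT (fun x : Y => x i).
Proof.
move=> _ A mA; rewrite setTI; apply: sub_sigma_algebra.
by exists i, A.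
Qed.

Lemma measurable_power d' (T : measurableType d') (f : T -> Y) :
  (forall i, measurable_fun setT (fun t => f t i)) -> measurable_fun setT f.
Proof.
move=> mf; apply: (@measurability _ _ T Y _ f (coordinate_sets I X) erefl).
move=> _ [_ [i [A [mA ->]]] <-]; exact: mf.
Qed.

End Coordinates.

Section PowerSpace.
Context {R : realType} {I : eqType} {d} {X : measurableType d}.
Context (mu : probability X R).
Local Notation Y := (power_space I X).

Definition box n (i : 'I_n -> I) (A : 'I_n -> set X) : set Y :=
  [set x | forall k, A k (x (i k))].

Definition boxes : set (set Y) := [set B | exists n (i : 'I_n -> I) A,
  [/\ injective i, forall k, measurable (A k) & B = box i A]].

Lemma measurable_box n (i : 'I_n -> I) (A : 'I_n -> set X) :
  (forall k, measurable (A k)) -> measurable (box i A).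
Proof.
move=> mA; rewrite (_ : box i A = \bigcap_(k in [set: 'I_n])
    ((fun x : Y => x (i k)) @^-1` A k)); last first.
  by apply/seteqP; split => [x xA k _|x xA k]; [exact: xA|exact: xA].
apply: fin_bigcap_measurable => // k _.
apply: measurable_preimage => //; exact: measurable_coord.
Qed.

(** Cylinders given by a list of coordinates are easier to intersect than boxes,
    which are indexed injectively; this lemma and the next one convert between
    the two descriptions. *)
Lemma boxesP (s : seq I) (A : I -> set X) : uniq s ->
  (forall i, measurable (A i)) ->
  boxes [set x | forall i, i \in s -> A i (x i)].
Proof.
move=> us mA.
exists (size s), (tnth (in_tuple s)), (fun k => A (tnth (in_tuple s) k)).
split => //; first exact/tuple_uniqP.
apply/seteqP; split => x xA /=.
  by move=> k; apply: xA; exact: mem_tnth.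
by move=> i /(tnthP (in_tuple s))[k ->]; exact: xA.
Qed.

Lemma boxes_cylinder B : boxes B -> exists (s : seq I) (A : I -> set X),
  (forall i, measurable (A i)) /\ B = [set x | forall i, i \in s -> A i (x i)].
Proof.
move=> [n [i [A [inji mA ->]]]].
exists [seq i k | k <- enum 'I_n],
  (fun j => \bigcap_(k in [set k | i k = j]) A k); split.
  by move=> j; apply: fin_bigcap_measurable => //; exact: finite_finset.
apply/seteqP; split => x xA /=.
  move=> j _ k /= <-; exact: xA.
move=> k; apply: (xA (i k)) => //; apply: map_f; exact: mem_enum.
Qed.

Lemma setI_closed_boxes : setI_closed boxes.
Proof.
move=> _ _ /boxes_cylinder[s [A [mA ->]]] /boxes_cylinder[t [B [mB ->]]].
pose C i := (if i \in s then A i else setT) `&` (if i \in t then B i else setT).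
rewrite (_ : _ `&` _ = [set x | forall i, i \in undup (s ++ t) -> C i (x i)]).
  apply: (@boxesP _ C); first exact: undup_uniq.
  by move=> i; apply: measurableI; case: ifP.
apply/seteqP; split => x /=.
  by move=> [xA xB] i _; split; case: ifPn => // ?; [exact: xA|exact: xB].
move=> xAB; split => i ii; have := xAB i; rewrite mem_undup mem_cat /C ii ?orbT.
  by move=> /(_ isT)[].
by move=> /(_ isT)[_].
Qed.

(** Together with [setI_closed_boxes], this makes boxes a generating pi-system,
    so that a probability on the power space is determined by its boxes. *)
Lemma sigma_boxes : (measurable : set (set Y)) = <<s boxes >>.
Proof.
apply/seteqP; split; apply: smallest_sub.
- exact: smallest_sigma_algebra.
- move=> _ [i [A [mA ->]]]; apply: sub_sigma_algebra.
  rewrite (_ : [set _ | _] = [set x | forall j, j \in [:: i] -> A (x j)]).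
    exact: (@boxesP _ (fun=> A)).
  apply/seteqP; split => x /= xA; last exact: (xA i (mem_head _ _)).
  by move=> j; rewrite inE => /eqP ->.
- exact: sigma_algebra_measurable.
- by move=> _ [n [i [A [_ mA ->]]]]; exact: measurable_box.
Qed.

Lemma power_measure_unique (eta eta' : probability Y R) :
  is_product_measure mu eta -> is_product_measure mu eta' ->
  forall B, measurable B -> eta B = eta' B.
Proof.
move=> Heta Heta' B mB.
apply: (measure_unique boxes (fun=> setT)) => //.
- exact: sigma_boxes.
- exact: setI_closed_boxes.
- move=> _.
  have := @boxesP [::] (fun=> setT) isT (fun=> measurableT).
  by congr boxes; apply/seteqP; split.
- by apply/seteqP; split => // x _; exists 0%N.
- move=> _ [n [i [A [inji mA ->]]]].
  exact: etrans (Heta _ _ _ inji mA) (esym (Heta' _ _ _ inji mA)).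
- by move=> _; exact: le_lt_trans (probability_le1 eta measurableT) (ltry _).
Qed.

Lemma product_measure_coord (eta : probability Y R) (i : I) (A : set X) :
  is_product_measure mu eta -> measurable A ->
  eta ((fun x => x i) @^-1` A) = mu A.
Proof.
move=> Heta mA; transitivity (\prod_(k < 1) mu A)%E; last by rewrite big_ord1.
rewrite -(Heta _ (fun=> i) (fun=> A))//; last by move=> j k _; rewrite !ord1.
by congr (eta _); apply/seteqP; split=> [x xA _|x /(_ ord0)].
Qed.

(** Injectivity of the relabelling is what makes the preimage of a box a box
    again, with the measures of its factors unchanged. With [a] an element of
    Gamma0 this covers the co-induced action, and with [a] the identity the
    underlying permutation of the coordinates. *)
Lemma relabel_preserves (eta : probability Y R) (p : I -> I)
    (a : I -> X -> X) :
  is_product_measure mu eta -> injective p ->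
  (forall i, measurable_fun setT (a i)) ->
  (forall i A, measurable A -> mu (a i @^-1` A) = mu A) ->
  let f : Y -> Y := fun x i => a i (x (p i)) in
  measurable_fun setT f /\
  forall B, measurable B -> eta (f @^-1` B) = eta B.
Proof.
move=> Heta injp ma mua f.
have mf : measurable_fun setT f.
  apply: measurable_power => i; apply: measurableT_comp => //.
  exact: measurable_coord.
split=> // B mB.
apply: (power_measure_unique (eta := image_prob eta mf) _ Heta) => //.
move=> n i A inji mA.
transitivity (\prod_(k < n) mu (a (i k) @^-1` A k))%E; last first.
  by apply: eq_bigr => k _; exact: mua.
rewrite -(Heta _ (fun k => p (i k)))//; first by move=> j k /injp /inji.
by move=> k; exact: measurable_preimage.
Qed.

End PowerSpace.

(** * Separating families, diagonals and atoms *)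

Section SeparatingSets.
Context {R : realType} {d} {X : measurableType d}.

(** Take the balls with centre in a countable dense set and radius 1 / (k + 1);
    interiors of balls are used because they are open by construction. *)
Lemma standard_borel_separated : standard_borel (R := R) X ->
  exists A : nat -> set X, (forall n, measurable (A n)) /\
    forall x y, (forall n, A n x <-> A n y) -> x = y.
Proof.
move=> [M [f [[_ [S cS dS]] bijf mX]]].
have [g injg] := countable_injP _ cS.
(* The pair p codes the centre s, through g s = p.1, and the radius; as g is
   injective on S the union has at most one term. *)
pose U (p : nat * nat) : set M :=
  \bigcup_(s in [set s | S s /\ g s = p.1]) (ball s p.2.+1%:R^-1)°.
pose A n := f @^-1` U (odflt (0, 0)%N (unpickle n)).
exists A; split=> [n|x y Axy].
  rewrite mX; exists (U (odflt (0, 0)%N (unpickle n))) => //.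
  apply: sub_sigma_algebra; apply: bigcup_open => s _; exact: open_interior.
apply: (bij_inj bijf); apply/eqP/negPn/negP; rewrite -mdist_gt0 => fxy0.
have [k] := ltr_add_invr (divr_gt0 fxy0 (ltr0n R 2)).
rewrite add0r; set e : R := k.+1%:R^-1 => efxy.
have e0 : 0 < e / 2 by rewrite divr_gt0 ?invr_gt0.
have [||s [/interior_subset xs Ss]] := dS (ball (f x) (e / 2))°.
- by exists (f x); exact: nbhsx_ballx.
- exact: open_interior.
have fxs : (ball s e)° (f x).
  apply: filterS (nbhsx_ballx (f x) (e / 2) e0) => z xz.
  by rewrite [e]splitr; apply: ball_triangle xz; exact: ball_sym.
have /Axy : A (pickle (g s, k)) x by rewrite /A pickleK; exists s.
rewrite /A pickleK => -[t [St gts] /interior_subset].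
have -> : t = s by apply: injg => //; rewrite inE.
move=> /(ball_triangle xs); rewrite ballEmdist /= -/e; lra.
Qed.

Lemma diag_measurable (A : nat -> set X) : (forall n, measurable (A n)) ->
  (forall x y, (forall n, A n x <-> A n y) -> x = y) ->
  measurable [set z : X * X | z.1 = z.2].
Proof.
move=> mA sepA.
rewrite (_ : [set _ | _] =
  \bigcap_n ((A n `*` A n) `|` ((~` A n) `*` (~` A n)))); last first.
  apply/seteqP; split => -[x y] /=.
    by move=> -> n _; have [?|?] := pselect (A n y); [left|right].
  move=> H; apply: sepA => n.
  by have [] := H n I; case=> /= ? ?; split.
apply: bigcapT_measurable => n; apply: measurableU; apply: measurableX => //;
  exact: measurableC.
Qed.

Lemma set1_measurable (x : X) : measurable [set z : X * X | z.1 = z.2] ->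
  measurable [set x].
Proof.
move=> /(measurable_xsection x); congr measurable.
by apply/seteqP; split => y; rewrite xsectionE/= => ->.
Qed.

Lemma diag_power_measurable (J : Type) : countable [set: J] ->
  measurable [set z : X * X | z.1 = z.2] ->
  measurable [set z : power_space J X * power_space J X | z.1 = z.2].
Proof.
move=> cI mD.
rewrite (_ : [set _ | _] = ~` \bigcup_(i : J) ~`
   ((fun z : power_space J X * power_space J X => (z.1 i, z.2 i)) @^-1`
     [set z | z.1 = z.2])); last first.
  rewrite setC_bigcup; apply/seteqP; split => -[x y] /= xy.
    by move=> i _; rewrite setCK /= xy.
  by apply/funext => i; have := xy i I; rewrite setCK.
apply: measurableC; apply: countable_bigcupT_measurable => // i.
apply: measurableC; apply: measurable_preimage => //.
apply: measurable_fun_pair; apply: (measurableT_comp (measurable_coord i)) => //.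
Qed.

End SeparatingSets.

Section Atomless.
Context {R : realType} {d} {X : measurableType d} (mu : probability X R).
Hypothesis atomless_mu : atomless mu.

Lemma atomless_set1 (x : X) : measurable [set x] -> mu [set x] = 0%E.
Proof.
move=> mx; apply/eqP; rewrite -measure_le0 leNgt; apply/negP => /(atomless_mu mx).
move=> [B [mB Bx B0]]; suff -> : B = [set x] by rewrite ltxx.
apply/seteqP; split=> // _ ->.
have [y By] : B !=set0.
  by apply/set0P/eqP => B_eq0; move: B0; rewrite B_eq0 measure0 ltxx.
by rewrite -(Bx y By).
Qed.

(** A set of positive measure contains one of at most half its measure: either
    the proper part given by atomlessness, or its complement. *)
Lemma atomless_small (n : nat) : exists C : set X,
  [/\ measurable C, (0 < mu C)%E & (mu C <= (2^-1 ^+ n)%:E)%E].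
Proof.
elim: n => [|n [C [mC C0 Cn]]].
  by exists setT; rewrite probability_setT expr0; split.
have [B [mB BC B0 BltC]] := atomless_mu mC C0.
have mBf := fin_num_measure mu _ mB.
have mCf := fin_num_measure mu _ mC.
have mCB : mu (C `\` B) = (mu C - mu B)%E.
  by rewrite measureD ?setIidr// ltey_eq mCf.
move: Cn B0 BltC mCB.
rewrite -[X in (X <= _)%E]fineK// -[mu B]fineK// -[mu C]fineK//.
rewrite lee_fin !lte_fin -EFinB exprS => Cn B0 BltC mCB.
have [Bs|Bl] := leP (fine (mu B)) (fine (mu C) / 2).
  exists B; rewrite -[mu B]fineK// lte_fin lee_fin; split=> //; lra.
exists (C `\` B); rewrite mCB lte_fin lee_fin; split; first exact: measurableD.
- by rewrite subr_gt0.
- by lra.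
Qed.

End Atomless.

(** * Reduction to real bounded functions *)

Section ComplexToReal.
Context {R : realType}.

Lemma normc_real (a : R) : `|a%:C%C| = `|a|%:C%C.
Proof. by rewrite normc_def /= expr0n addr0 sqrtr_sqr. Qed.

Lemma normc_i : `|'i%C : R[i]| = 1.
Proof. by rewrite normc_def /= expr0n expr1n add0r sqrtr1. Qed.

Lemma normc_ge_Im (z : R[i]) : `|complex.Im z|%:C%C <= `|z|.
Proof.
by rewrite -normrN -ReiNIm (le_trans (normc_ge_Re _))// normrM normc_i mulr1.
Qed.

Lemma normc_le_ReIm (z : R[i]) :
  `|z| <= (`|complex.Re z| + `|complex.Im z|)%:C%C.
Proof.
rewrite {1}[z]complexE (le_trans (ler_normD _ _))// normrM normc_i mul1r.
by rewrite !normc_real -rmorphD.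
Qed.

(** Additive functionals dominated by the modulus are continuous; stated once
    for both the real and the imaginary part. *)
Lemma measurable_real_functional d (X : measurableType d) (f : R[i] -> R)
    (phi : X -> R[i]) :
  (forall z w, f (z - w) = f z - f w) -> (forall z, `|f z|%:C%C <= `|z|) ->
  measurable_fun setT (phi : X -> g_sigma_algebraType (@open R[i]^o)) ->
  measurable_fun setT (f \o phi).
Proof.
move=> fB f1 mphi; apply: (measurability _ (RGenOInfty.measurableE R)) => //.
move=> _ [_ [a ->] <-]; rewrite setTI comp_preimage.
rewrite -[X in measurable X]setTI; apply: mphi => //.
apply: sub_sigma_algebra; rewrite /= openE => z /=; rewrite in_itv/= andbT => az.
apply/nbhs_ballP; exists ((f z - a)%:C)%C; first by rewrite /= ltcR subr_gt0.
move=> w; rewrite /ball /= => zw; rewrite in_itv/= andbT.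
have := le_lt_trans (f1 _) zw; rewrite ltcR fB => /(le_lt_trans (ler_norm _)).
by rewrite ltrD2l ltrN2.
Qed.

Definition bounded_measurable d (X : measurableType d) (f : X -> R) :=
  measurable_fun setT f /\ exists K, forall x, `|f x| <= K.

Lemma bounded_borel_real_functional d (X : measurableType d) (f : R[i] -> R)
    (phi : X -> R[i]) :
  (forall z w, f (z - w) = f z - f w) -> (forall z, `|f z|%:C%C <= `|z|) ->
  bounded_borel phi -> bounded_measurable (f \o phi).
Proof.
move=> fB f1 [mphi [M phiM]]; split; first exact: measurable_real_functional.
exists (complex.Re M) => x /=.
by have := le_trans (f1 _) (phiM x); rewrite lecE => /andP[].
Qed.

Lemma bounded_borel_Re d (X : measurableType d) (phi : X -> R[i]) :
  bounded_borel phi -> bounded_measurable (@complex.Re R \o phi).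
Proof.
apply: bounded_borel_real_functional; last exact: normc_ge_Re.
by move=> [a b] [c e].
Qed.

Lemma bounded_borel_Im d (X : measurableType d) (phi : X -> R[i]) :
  bounded_borel phi -> bounded_measurable (@complex.Im R \o phi).
Proof.
apply: bounded_borel_real_functional; last exact: normc_ge_Im.
by move=> [a b] [c e].
Qed.

Lemma cvg_ReIm (u : nat -> R[i]) (l : R[i]) :
  (fun n => complex.Re (u n)) @ \oo --> complex.Re l ->
  (fun n => complex.Im (u n)) @ \oo --> complex.Im l ->
  (u : nat -> R[i]^o) @ \oo --> (l : R[i]^o).
Proof.
move=> /cvgrPdist_lt uRe /cvgrPdist_lt uIm; apply/cvgrPdist_lt => e.
rewrite ltcE => /andP[/eqP eIm eRe].
have e2 : 0 < complex.Re e / 2 by rewrite divr_gt0.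
near=> n.
have hRe : `|complex.Re l - complex.Re (u n)| < complex.Re e / 2.
  by near: n; exact: uRe.
have hIm : `|complex.Im l - complex.Im (u n)| < complex.Re e / 2.
  by near: n; exact: uIm.
have -> : e = (complex.Re e)%:C%C by apply/eqP; rewrite eq_complex/= eIm !eqxx.
apply: le_lt_trans (normc_le_ReIm _) _; rewrite ltcR.
rewrite [complex.Re e]splitr; apply: ltrD.
  by move: hRe; case: (l) (u n) => [? ?] [].
by move: hIm; case: (l) (u n) => [? ?] [].
Unshelve. all: by end_near. Qed.

End ComplexToReal.

Section BoundedIntegrals.
Context {R : realType} {d} {T : measurableType d} (P : probability T R).

Lemma bounded_measurable_integrable (f : T -> R) : bounded_measurable f ->
  P.-integrable setT (EFin \o f).
Proof.
move=> [mf [K fK]]; apply: measurable_bounded_integrable => //.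
  exact: le_lt_trans (probability_le1 P measurableT) (ltry _).
exists K; split; first exact: num_real.
by move=> x Kx t _; exact: le_trans (fK t) (ltW Kx).
Qed.

Lemma bounded_measurableM (f g : T -> R) : bounded_measurable f ->
  bounded_measurable g -> bounded_measurable (fun x => f x * g x).
Proof.
move=> [mf [K fK]] [mg [L gL]]; split; first exact: measurable_funM.
by exists (K * L) => x; rewrite normrM ler_pM.
Qed.

Lemma bounded_measurableB (f g : T -> R) : bounded_measurable f ->
  bounded_measurable g -> bounded_measurable (fun x => f x - g x).
Proof.
move=> [mf [K fK]] [mg [L gL]]; split; first exact: measurable_funB.
exists (K + L) => x; apply: le_trans (ler_normB _ _) _; exact: lerD.
Qed.

Lemma bounded_measurableD (f g : T -> R) : bounded_measurable f ->
  bounded_measurable g -> bounded_measurable (fun x => f x + g x).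
Proof.
move=> [mf [K fK]] [mg [L gL]]; split; first exact: measurable_funD.
exists (K + L) => x; apply: le_trans (ler_normD _ _) _; exact: lerD.
Qed.

Lemma bounded_measurable_comp d' (U : measurableType d') (f : U -> R)
    (h : T -> U) : measurable_fun setT h -> bounded_measurable f ->
  bounded_measurable (f \o h).
Proof.
move=> mh [mf [K fK]]; split; first exact: measurableT_comp.
by exists K => x; exact: fK.
Qed.

Lemma Rintegral_image_prob d' (U : measurableType d') (f : U -> R)
    (h : T -> U) (mh : measurable_fun setT h) : bounded_measurable f ->
  (\int[image_prob P mh]_x f x)%R = (\int[P]_x f (h x))%R.
Proof.
move=> bf; rewrite /Rintegral; congr fine.
apply: integral_pushforward => //; first by apply/measurable_EFinP; case: bf.
rewrite preimage_setT.
exact: (bounded_measurable_integrable (bounded_measurable_comp mh bf)).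
Qed.

Lemma cintegral_image_prob d' (U : measurableType d') (f : U -> R[i])
    (h : T -> U) (mh : measurable_fun setT h) :
  bounded_measurable (@complex.Re R \o f) ->
  bounded_measurable (@complex.Im R \o f) ->
  cintegral (image_prob P mh) f = cintegral P (f \o h).
Proof.
move=> fRe fIm; rewrite /cintegral.
by rewrite (Rintegral_image_prob mh fRe) (Rintegral_image_prob mh fIm).
Qed.

End BoundedIntegrals.

Section ProductIntegrals.
Context {R : realType} {d} {T : measurableType d} {d'} {X : measurableType d'}.
Context (f g : T -> X) (phi psi : X -> R[i]).
Hypothesis mf : measurable_fun setT f.
Hypothesis mg : measurable_fun setT g.
Hypothesis bphi : bounded_borel phi.
Hypothesis bpsi : bounded_borel psi.

Lemma Re_prod (a b : R[i]) : complex.Re (a * b) =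
  complex.Re a * complex.Re b - complex.Im a * complex.Im b.
Proof. by case: a b => [? ?] []. Qed.

Lemma Im_prod (a b : R[i]) : complex.Im (a * b) =
  complex.Re a * complex.Im b + complex.Im a * complex.Re b.
Proof. by case: a b => [? ?] []. Qed.

Let bfRe := bounded_measurable_comp mf (bounded_borel_Re bphi).
Let bfIm := bounded_measurable_comp mf (bounded_borel_Im bphi).
Let bgRe := bounded_measurable_comp mg (bounded_borel_Re bpsi).
Let bgIm := bounded_measurable_comp mg (bounded_borel_Im bpsi).

Lemma bounded_measurable_Re_prod :
  bounded_measurable (@complex.Re R \o (fun w => phi (f w) * psi (g w))).
Proof.
have := bounded_measurableB (bounded_measurableM bfRe bgRe)
  (bounded_measurableM bfIm bgIm).
by congr bounded_measurable; apply/funext => w /=; rewrite Re_prod.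
Qed.

Lemma bounded_measurable_Im_prod :
  bounded_measurable (@complex.Im R \o (fun w => phi (f w) * psi (g w))).
Proof.
have := bounded_measurableD (bounded_measurableM bfRe bgIm)
  (bounded_measurableM bfIm bgRe).
by congr bounded_measurable; apply/funext => w /=; rewrite Im_prod.
Qed.

Lemma Re_cintegral_prod (P : probability T R) :
  complex.Re (cintegral P (fun w => phi (f w) * psi (g w))) =
  (\int[P]_w (complex.Re (phi (f w)) * complex.Re (psi (g w))))%R -
  (\int[P]_w (complex.Im (phi (f w)) * complex.Im (psi (g w))))%R.
Proof.
rewrite /= -RintegralB//.
- by apply: eq_Rintegral => w _; rewrite Re_prod.
- exact: bounded_measurable_integrable (bounded_measurableM bfRe bgRe).
- exact: bounded_measurable_integrable (bounded_measurableM bfIm bgIm).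
Qed.

Lemma Im_cintegral_prod (P : probability T R) :
  complex.Im (cintegral P (fun w => phi (f w) * psi (g w))) =
  (\int[P]_w (complex.Re (phi (f w)) * complex.Im (psi (g w))))%R +
  (\int[P]_w (complex.Im (phi (f w)) * complex.Re (psi (g w))))%R.
Proof.
rewrite /= -RintegralD//.
- by apply: eq_Rintegral => w _; rewrite Im_prod.
- exact: bounded_measurable_integrable (bounded_measurableM bfRe bgIm).
- exact: bounded_measurable_integrable (bounded_measurableM bfIm bgRe).
Qed.

End ProductIntegrals.

(** * Maps that become equal in measure *)

Section SmallMeasures.
Context {R : realType} {d} {T : measurableType d} (P : probability T R).

(** Convergence of the measures of [E n] to 0, in the epsilon form in which it
    is combined below. *)
Definition vanishing (E : nat -> set T) :=
  forall e : R, 0 < e -> \forall n \near \oo, (P (E n) <= e%:E)%E.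

Lemma vanishing_sub (E F : nat -> set T) :
  (forall n, measurable (E n)) -> (forall n, measurable (F n)) ->
  (forall n, E n `<=` F n) -> vanishing F -> vanishing E.
Proof.
move=> mE mF EF vF e e0; near=> n.
apply: (@le_trans _ _ (P (F n))); first by apply: le_measure; rewrite ?inE.
by near: n; exact: vF.
Unshelve. all: by end_near. Qed.

Lemma vanishingU (E F : nat -> set T) :
  (forall n, measurable (E n)) -> (forall n, measurable (F n)) ->
  vanishing E -> vanishing F -> vanishing (fun n => E n `|` F n).
Proof.
move=> mE mF vE vF e e0; have e2 : 0 < e / 2 by rewrite divr_gt0.
near=> n; apply: (le_trans (measureU2 _ (mE n) (mF n))).
rewrite [e]splitr EFinD; apply: leeD; near: n; [exact: vE|exact: vF].
Unshelve. all: by end_near. Qed.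

Lemma vanishing0 : vanishing (fun=> set0).
Proof. by move=> e e0; near=> n; rewrite measure0 lee_fin ltW.
Unshelve. all: by end_near. Qed.

Lemma vanishing_bigsetU (N : nat) (E : nat -> nat -> set T) :
  (forall k n, measurable (E k n)) -> (forall k, vanishing (E k)) ->
  vanishing (fun n => \big[setU/set0]_(k < N) E k n).
Proof.
move=> mE vE; elim: N => [|N IH].
  by under eq_fun do rewrite big_ord0; exact: vanishing0.
under eq_fun do rewrite big_ord_recr/=.
by apply: vanishingU => // n; exact: bigsetU_measurable.
Qed.

Lemma cvg0_vanishing (E : nat -> set T) :
  (fun n => P (E n)) @ \oo --> 0%E -> vanishing E.
Proof.
move=> /fine_cvgP[Efin /cvgrPdist_le cE] e e0; near=> n.
rewrite -[P (E n)]fineK; last by near: n.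
rewrite lee_fin; apply: le_trans (ler_norm _) _.
by rewrite -normrN -sub0r; near: n; exact: cE.
Unshelve. all: by end_near. Qed.

End SmallMeasures.

Section EqualInTheLimit.
Context {R : realType} {d} {W : measurableType d} (P : probability W R).
Context {d'} {T : measurableType d'} (x : W -> T) (y : nat -> W -> T).
Hypothesis mx : measurable_fun setT x.
Hypothesis my : forall n, measurable_fun setT (y n).

Definition discrepancy (B : set T) (n : nat) : set W :=
  (x @^-1` B `\` y n @^-1` B) `|` (y n @^-1` B `\` x @^-1` B).

Lemma measurable_discrepancy B n : measurable B -> measurable (discrepancy B n).
Proof.
move=> mB; have mxB := measurable_preimage mx mB.
have myB := measurable_preimage (my n) mB.
by apply: measurableU; exact: measurableD.
Qed.

Lemma discrepancyU A B n :
  discrepancy (A `|` B) n `<=` discrepancy A n `|` discrepancy B n.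
Proof.
move=> w; rewrite /discrepancy/=.
by have [|] := pselect (A (x w)); have [|] := pselect (A (y n w)); tauto.
Qed.

Lemma discrepancyC B n : discrepancy (~` B) n = discrepancy B n.
Proof.
apply/seteqP; rewrite /discrepancy; split => w /=;
  by have [|] := pselect (B (x w)); have [|] := pselect (B (y n w)); tauto.
Qed.

(** Once a countable union is replaced by a finite one, what remains only
    involves the values of [x] and [y n] in a set of small measure. *)
Lemma discrepancy_truncate (F : nat -> set T) N n :
  discrepancy (\bigcup_k F k) n `<=`
  discrepancy (\big[setU/set0]_(k < N) F k) n `|`
  (x @^-1` (\bigcup_k F k `\` \big[setU/set0]_(k < N) F k) `|`
   y n @^-1` (\bigcup_k F k `\` \big[setU/set0]_(k < N) F k)).
Proof.
set U := \bigcup_k F k; set V := \big[setU/set0]_(k < N) F k.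
have VU : V `<=` U by exact: bigsetU_bigcup.
move=> w; have := VU (x w); have := VU (y n w); rewrite /discrepancy /=.
by have [|] := pselect (V (x w)); have [|] := pselect (V (y n w)); tauto.
Qed.

(** The sets with vanishing discrepancy form a sigma-algebra. For countable
    unions, the tail left by [discrepancy_truncate] has the same probability for
    [x] and for [y n], uniformly in [n], since these maps have the same law. *)
Lemma vanishing_discrepancy (G : set (set T)) :
  (measurable : set (set T)) = <<s G >> ->
  (forall n B, measurable B -> P (y n @^-1` B) = P (x @^-1` B)) ->
  (forall B, G B -> vanishing P (discrepancy B)) ->
  forall B, measurable B -> vanishing P (discrepancy B).
Proof.
move=> mG law GP.
suff H : <<s G >> `<=` [set B | measurable B /\ vanishing P (discrepancy B)].
  by move=> B; rewrite mG => /H[].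
apply: smallest_sub; last first.
  by move=> B GB; split; [rewrite mG; exact: sub_sigma_algebra|exact: GP].
split.
- split=> //; have -> : discrepancy set0 = fun=> set0; last exact: vanishing0.
  by apply/funext => n; rewrite /discrepancy !preimage_set0 setDv setU0.
- move=> B [mB vB]; rewrite setTD; split; first exact: measurableC.
  by have -> : discrepancy (~` B) = discrepancy B
    by apply/funext => n; exact: discrepancyC.
- move=> F FP; have mF k : measurable (F k) by have [] := FP k.
  pose V N := \big[setU/set0]_(k < N) F k; pose U := \bigcup_k F k.
  have mV N : measurable (V N) by exact: bigsetU_measurable.
  have mU : measurable U by exact: bigcupT_measurable.
  have vV N : vanishing P (discrepancy (V N)).
    apply: (vanishing_sub
      (F := fun n => \big[setU/set0]_(k < N) discrepancy (F k) n)).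
    + by move=> n; exact: measurable_discrepancy.
    + move=> n; apply: bigsetU_measurable => k _.
      exact: measurable_discrepancy.
    + move=> n; rewrite /V; elim: N => [|N IH].
        by rewrite !big_ord0 /discrepancy !preimage_set0 setDv setU0.
      rewrite !big_ord_recr/=; apply: subset_trans (@discrepancyU _ _ _) _.
      exact: setSU.
    + apply: (@vanishing_bigsetU _ _ _ P N (fun k => discrepancy (F k))) => k;
        last by have [] := FP k.
      by move=> n; exact: measurable_discrepancy.
  split=> // e e0; have e4 : 0 < e / 4 by rewrite divr_gt0.
  have [N PN] : exists N, (P (x @^-1` (U `\` V N)) <= (e / 4)%:E)%E.
    suff vx : vanishing P (fun N => x @^-1` (U `\` V N)).
      have [N _ /(_ N (leqnn N)) PN] := vx _ e4; by exists N.
    apply: cvg0_vanishing.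
    have -> : 0%E = P (\bigcap_N x @^-1` (U `\` V N)).
      rewrite (_ : \bigcap_N _ = set0) ?measure0//.
      apply/seteqP; split=> // w xw; have [[k _ Fk] _] := xw 0%N Logic.I.
      have [_] := xw k.+1 Logic.I; apply; rewrite /V -bigcup_mkord.
      by exists k => //=.
    apply: nonincreasing_cvg_mu.
    + apply: le_lt_trans (probability_le1 _ _) (ltry _).
      exact: measurable_preimage mx (measurableD mU (mV 0%N)).
    + by move=> N; apply: measurable_preimage => //; exact: measurableD.
    + apply: bigcapT_measurable => N.
      by apply: measurable_preimage => //; exact: measurableD.
    + move=> m N mN; apply/subsetPset => w /= [Uw Vw]; split=> // Vmw; apply: Vw.
      move: Vmw; rewrite /V -!bigcup_mkord => -[k /= km Fk].
      by exists k => //=; exact: leq_trans km mN.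
  near=> n.
  have mxUV := measurable_preimage mx (measurableD mU (mV N)).
  have myUV := measurable_preimage (my n) (measurableD mU (mV N)).
  apply: (@le_trans _ _ (P (discrepancy (V N) n `|`
      (x @^-1` (U `\` V N) `|` y n @^-1` (U `\` V N))))).
    apply: le_measure; rewrite ?inE; last exact: discrepancy_truncate.
    + exact: measurable_discrepancy.
    + by apply: measurableU; [exact: measurable_discrepancy|exact: measurableU].
  apply: le_trans (measureU2 _ (measurable_discrepancy _ (mV N))
    (measurableU _ _ mxUV myUV)) _.
  rewrite (_ : e%:E = ((e / 2)%:E + ((e / 4)%:E + (e / 4)%:E))%E); last first.
    by rewrite -!EFinD; congr EFin; field.
  apply: leeD; first by near: n; apply: vV; rewrite divr_gt0.
  apply: le_trans (measureU2 _ mxUV myUV) _.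
  by apply: leeD => //; apply: le_trans PN; rewrite -(law n)//; exact: measurableD.
Unshelve. all: by end_near. Qed.

(** Cut the range of [psi] into finitely many intervals of length [dl]. Away
    from the discrepancies of the corresponding level sets, [psi (x w)] and
    [psi (y n w)] lie in the same interval, hence differ by at most [dl]. *)
Lemma cvg_integral_of_discrepancy (phi psi : T -> R) :
  (forall B, measurable B -> vanishing P (discrepancy B)) ->
  bounded_measurable phi -> bounded_measurable psi ->
  (fun n => \int[P]_w (phi (x w) * psi (y n w)))%R @ \oo -->
  (\int[P]_w (phi (x w) * psi (x w)))%R.
Proof.
move=> vD bphi bpsi; have [mphi [K0 phiK0]] := bphi.
have [mpsi [M0 psiM0]] := bpsi.
pose K := `|K0| + 1; pose M := `|M0| + 1.
have K_gt0 : 0 < K by rewrite ltr_pwDr.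
have M_gt0 : 0 < M by rewrite ltr_pwDr.
have phiK t : `|phi t| <= K.
  by apply: le_trans (phiK0 t) _; rewrite ler_wpDr// ler_norm.
have psiM t : `|psi t| <= M.
  by apply: le_trans (psiM0 t) _; rewrite ler_wpDr// ler_norm.
apply/cvgrPdist_lt => e e_gt0.
(* Each of the two terms of the bound [key] below gets a budget e / 4. *)
pose dl := e / (4 * K).
have dl_gt0 : 0 < dl by rewrite divr_gt0// mulr_gt0.
pose N := (Num.truncn ((M + M) / dl)).+1.
have MN : M + M < N%:R * dl.
  rewrite -ltr_pdivrMr//; exact: truncnS_gt.
pose B j := psi @^-1` [set r | (j%:R * dl <= r + M) && (r + M < j.+1%:R * dl)].
have mB j : measurable (B j).
  apply: measurable_preimage => //.
  rewrite (_ : [set r | _] = `[j%:R * dl - M, j.+1%:R * dl - M[%classic).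
    exact: measurable_itv.
  by apply/seteqP; split=> r /=; rewrite in_itv/= lerBlDr ltrBrDr.
pose E n := \big[setU/set0]_(j < N) discrepancy (B j) n.
have mE n : measurable (E n).
  by apply: bigsetU_measurable => j _; exact: measurable_discrepancy.
have vE : vanishing P E.
  apply: (@vanishing_bigsetU _ _ _ P N (fun j => discrepancy (B j))) => [j n|j].
    exact: measurable_discrepancy.
  exact: vD.
have key n w : `|phi (x w) * psi (x w) - phi (x w) * psi (y n w)| <=
    K * dl + K * (M + M) * \1_(E n) w.
  rewrite -mulrBr normrM -mulrA -mulrDr; apply: ler_pM => //.
  have rx0 : 0 <= psi (x w) + M by have := psiM (x w); rewrite ler_norml; lra.
  have /andP[jx xj] := truncn_itv (divr_ge0 rx0 (ltW dl_gt0)).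
  move: jx xj; set j := Num.truncn _; rewrite ler_pdivlMr// ltr_pdivrMr// => jx xj.
  have jN : (j < N)%N.
    rewrite -(ltr_nat R) -(ltr_pM2r dl_gt0); apply: le_lt_trans jx _.
    apply: le_lt_trans MN; have := psiM (x w); rewrite ler_norml; lra.
  have [Ew|Ew] := pselect (E n w).
    rewrite indicE mem_set// mulr1.
    apply: (@le_trans _ _ (M + M)); last by rewrite lerDr ltW.
    by apply: le_trans (ler_normB _ _) _; exact: lerD.
  rewrite indicE memNset// mulr0 addr0.
  have yB : B j (y n w).
    apply/not_notP => yB; apply: Ew; rewrite /E.
    rewrite -(bigcup_mkord N (fun j => discrepancy (B j) n)).
    by exists j => //; left; split=> //; apply/andP; split.
  by move: yB => /= /andP[jy yj]; rewrite ler_distl; lra.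
have bx : bounded_measurable (fun w => phi (x w) * psi (x w)).
  by apply: bounded_measurableM; exact: (bounded_measurable_comp mx).
have by_ n : bounded_measurable (fun w => phi (x w) * psi (y n w)).
  apply: bounded_measurableM; first exact: (bounded_measurable_comp mx).
  exact: (bounded_measurable_comp (my n)).
have b1 n : bounded_measurable (\1_(E n) : W -> R).
  split; first exact: measurable_indic.
  by exists 1 => w; rewrite indicE; case: (_ \in _); rewrite ?normr1 ?normr0.
have bcst (c : R) : bounded_measurable (cst c : W -> R).
  by split=> //; exists `|c| => w.
pose tau := e / (4 * (K * (M + M))).
have tau_gt0 : 0 < tau by rewrite divr_gt0// !mulr_gt0// addr_gt0.
near=> n.
rewrite -RintegralB//; [|exact: bounded_measurable_integrable..].
apply: le_lt_trans (le_normr_Rintegral _ _) _ => //.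
  exact: (bounded_measurable_integrable P (bounded_measurableB bx (by_ n))).
apply: (@le_lt_trans _ _ (\int[P]_w (K * dl + K * (M + M) * \1_(E n) w))%R).
  apply: le_Rintegral => //.
  - apply: integrable_norm.
    exact: (bounded_measurable_integrable P (bounded_measurableB bx (by_ n))).
  - exact: (bounded_measurable_integrable P (bounded_measurableD (bcst _)
      (bounded_measurableM (bcst _) (b1 n)))).
rewrite RintegralD//; last 2 first.
- exact: (bounded_measurable_integrable P (bcst _)).
- exact: (bounded_measurable_integrable P (bounded_measurableM (bcst _) (b1 n))).
rewrite Rintegral_cst// [X in fine X](_ : _ = 1%E); last exact: probability_setT.
rewrite [fine 1%E]/= mulr1.
rewrite RintegralZl//; last exact: (bounded_measurable_integrable P (b1 n)).
rewrite /Rintegral integral_indic// setIT.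
have PE : fine (P (E n)) <= tau.
  rewrite -lee_fin fineK ?fin_num_measure//; by near: n; exact: vE.
have -> : K * dl = e / 4 by rewrite /dl; field; lra.
have : K * (M + M) * fine (P (E n)) <= e / 4.
  rewrite (_ : e / 4 = K * (M + M) * tau); last by rewrite /tau; field; lra.
  by rewrite ler_pM2l// mulr_gt0// addr_gt0.
lra.
Unshelve. all: by end_near. Qed.

End EqualInTheLimit.

(** * Fundamental domains and the co-induced action *)

Section FundamentalDomain.
Context {G : groupType} {S : pred G} (G0 : subGroupType S) (D : set G).
Hypothesis fundamental_D : fundamental_domain G0 D.

Lemma left_coset_mul (g : G) (s : G0) : left_coset G0 (g * val s)%g g.
Proof. by exists s^-1%g => //; rewrite gmulfV mulgK. Qed.

Lemma left_coset_refl (g : G) : left_coset G0 g g.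
Proof. by exists 1%g => //; rewrite gmulf1 mulg1. Qed.

(** The cosets of distinct representatives are disjoint. As a consequence any
    explicit factorization of g d identifies [dom_act g d] and [cocycle g d]. *)
Lemma factorization_unique (d e : D) (s t : G0) :
  (val d * val s = val e * val t)%g -> d = e /\ s = t.
Proof.
move=> dset; have de : d = e.
  have [f [_ uf]] := fundamental_D (val d * val s)%g; apply/val_inj.
  rewrite -(uf (val d)); last by split; [exact: set_valP|exact: left_coset_mul].
  by apply: uf; rewrite dset; split; [exact: set_valP|exact: left_coset_mul].
by split=> //; apply/val_inj/(mulgI (val d)); rewrite dset de.
Qed.

Lemma decompP (g : G) (d : D) :
  (g * val d = val (dom_act G0 g d) * val (cocycle G0 g d))%g.
Proof.
have [f [[Df [s _ fE]] _]] := fundamental_D (g * val d)%g.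
apply: (@xgetPex _ _ [set p : D * G0 | (g * val d = val p.1 * val p.2)%g]).
exists (SigSub (mem_set Df), s^-1%g) => /=.
by rewrite gmulfV -fE mulgK.
Qed.

(** If g d and g e have the same representative f, then both are f times an
    element of G0, so d and e lie in the same coset. *)
Lemma dom_act_inj (g : G) : injective (dom_act G0 (D := D) g).
Proof.
move=> d e de; have hd := decompP g d; have he := decompP g e.
suff [] : d = e /\ (cocycle G0 g d)^-1%g = (cocycle G0 g e)^-1%g by [].
apply: factorization_unique; apply: (mulgI g).
by rewrite !gmulfV !mulgA hd he de !mulgK.
Qed.

(** The inverse of e h e^-1 sends e to e h^-1, so that it fixes the coordinate
    [e] with cocycle [h^-1]. *)
Lemma coinduced_stabilizer d (X : measurableType d) (act : G0 -> X -> X)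
    (e : D) (h : G0) (x : power_space D X) :
  coinduced act (val e * val h * (val e)^-1)%g x e = act h (x e).
Proof.
have [dE sE] : dom_act G0 (val e * val h * (val e)^-1)^-1%g e = e /\
    cocycle G0 (val e * val h * (val e)^-1)^-1%g e = h^-1%g.
  apply: factorization_unique; rewrite -decompP gmulfV.
  by rewrite !invgM invgK !mulgA mulgVK.
by rewrite /coinduced dE sE invgK.
Qed.

Lemma finite_index_fundamental_domain :
  finite_index G0 <-> finite_set [set: D].
Proof.
split=> [fin|fin].
  have [d0 [[Dd0 _] _]] := fundamental_D 1%g.
  pose r C : D := 
    xget (SigSub (mem_set Dd0)) [set d : D | left_coset G0 (val d) = C].
  apply: sub_finite_set (finite_image r fin) => d _.
  exists (left_coset G0 (val d)); first by exists (val d).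
  have rd : left_coset G0 (val (r (left_coset G0 (val d)))) =
      left_coset G0 (val d).
    by apply: (@xgetPex _ _ [set e : D | left_coset G0 (val e) = _]); exists d.
  move: rd; set e := r _ => rd.
  have [s _ sE] : left_coset G0 (val d) (val e).
    by rewrite -rd; exact: left_coset_refl.
  suff [->] : d = e /\ s = 1%g by [].
  by apply: factorization_unique; rewrite sE gmulf1 mulg1.
apply: sub_finite_set (finite_image (fun d : D => left_coset G0 (val d)) fin).
move=> _ [g _ <-]; have [d [[Dd [s _ gs]] _]] := fundamental_D g.
exists (SigSub (mem_set Dd)) => //=; rewrite -gs.
apply/seteqP; split=> _ [t _ <-].
  by exists (s * t)%g => //; rewrite gmulfM mulgA.
by exists (s^-1 * t)%g => //; rewrite gmulfM gmulfV -mulgA mulVKg.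
Qed.

End FundamentalDomain.

(** * Total variation *)

Section TotalVariation.
Context {R : realType} d d' (T : measurableType d) (T' : measurableType d').
Implicit Types (rho : set T -> \bar R).
Local Open Scope ereal_scope.

Lemma tv_norm_ge0 rho : 0 <= tv_norm rho.
Proof.
apply: ereal_sup_ubound; exists 0%N, (fun=> set0); split=> //.
  exact: trivIset_set0.
by rewrite big_ord0.
Qed.

(** Disjoint families pull back to disjoint families. *)
Lemma tv_norm_image_le rho (f : T -> T') : measurable_fun setT f ->
  tv_norm (fun A => rho (f @^-1` A)) <= tv_norm rho.
Proof.
move=> mf; apply: ge_ereal_sup => _ [n [A [mA tA ->]]].
apply: ereal_sup_ubound; exists n, (fun i => f @^-1` A i); split=> //.
  by move=> i; exact: measurable_preimage.
apply/trivIsetP => i j _ _ ij; rewrite -preimage_setI.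
by move/trivIsetP : tA => /(_ i j I I ij) ->; rewrite preimage_set0.
Qed.

Lemma tv_norm_eq0 rho : (forall A, measurable A -> rho A = 0) ->
  tv_norm rho = 0.
Proof.
move=> rho0; apply/eqP; rewrite eq_le tv_norm_ge0 andbT.
apply: ge_ereal_sup => _ [n [A [mA _ ->]]].
by rewrite big1// => i _; rewrite rho0// abse0.
Qed.

End TotalVariation.

(** * Finite index implies rigidity *)

Section FiniteIndex.
Context {R : realType} {G : groupType} {S : pred G} {G0 : subGroupType S}.
Context {d} {X : measurableType d} (mu : probability X R) (act : G0 -> X -> X).
Context {D : set G} (fundamental_D : fundamental_domain G0 D).
Context (eta : probability (power_space D X) R).
Hypothesis product_eta : is_product_measure mu eta.
Hypothesis diagX : measurable [set z : X * X | z.1 = z.2].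
Local Notation Y := (power_space D X).

Definition coord_pair (e : D) (z : Y * Y) : X * X := (z.1 e, z.2 e).

Lemma measurable_coord_pair (e : D) : measurable_fun setT (coord_pair e).
Proof.
by apply: measurable_fun_pair; apply: (measurableT_comp (measurable_coord e)).
Qed.

(** The images of [nu] under [coord_pair e] satisfy the three conditions in the
    definition of rigidity of the action on X; for the third one, [h] is tested
    against the conjugate of [h] by the representative [e]. *)
Lemma rigid_coord (nu : nat -> probability (Y * Y)%type R) (e : D) :
  rigid mu act ->
  (forall n A, measurable A ->
     pushforward (nu n) fst A = eta A /\ pushforward (nu n) snd A = eta A) ->
  (forall phi psi : Y -> R[i], bounded_borel phi -> bounded_borel psi ->
     (fun n => cintegral (nu n) (fun z => phi z.1 * psi z.2) : R[i]^o)
       @ \oo --> (cintegral eta (fun x => phi x * psi x) : R[i]^o)) ->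
  (forall g,
     (fun n => tv_norm (fun A : set (Y * Y) =>
        pushforward (nu n)
          (fun z : Y * Y => (coinduced act g z.1, coinduced act g z.2)) A
          - nu n A)%E) @ \oo --> 0%E) ->
  (fun n => nu n (coord_pair e @^-1` [set z | z.1 = z.2])) @ \oo --> 1%E.
Proof.
move=> rigid_mu marg weak inv.
apply: (rigid_mu (fun n => image_prob (nu n) (measurable_coord_pair e))).
- move=> n A mA.
  have := marg n ((fun x : Y => x e) @^-1` A).
  rewrite (product_measure_coord e product_eta mA); apply.
  exact: measurable_preimage (measurable_coord e) mA.
- move=> phi psi bphi bpsi.
  have borel_coord (f : X -> R[i]) :
      bounded_borel f -> bounded_borel (fun y : Y => f (y e)).
    move=> [mf [M fM]]; split; last by exists M => y; exact: fM.
    exact: (measurableT_comp mf (measurable_coord e)).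
  have := weak _ _ (borel_coord _ bphi) (borel_coord _ bpsi).
  have -> : (fun n => cintegral (image_prob (nu n) (measurable_coord_pair e))
        (fun z => phi z.1 * psi z.2)) =
      (fun n => cintegral (nu n) (fun z => phi (z.1 e) * psi (z.2 e))).
    apply/funext => n; apply: cintegral_image_prob.
      exact: bounded_measurable_Re_prod.
    exact: bounded_measurable_Im_prod.
  have -> : cintegral mu (fun x => phi x * psi x) =
      cintegral (image_prob eta (measurable_coord e)) (fun x => phi x * psi x).
    rewrite /cintegral /Rintegral; congr (fine _ +i* fine _)%C;
      apply: eq_measure_integral => A mA _;
      exact: esym (product_measure_coord e product_eta mA).
  rewrite cintegral_image_prob//; first exact: bounded_measurable_Re_prod.
  exact: bounded_measurable_Im_prod.
- move=> h; apply: (@squeeze_cvge _ _ _ _ (cst 0%E) _ _ _ _ _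
    (inv (val e * val h * (val e)^-1)%g)); last exact: cvg_cst.
  near=> n; rewrite tv_norm_ge0/=.
  apply: le_trans (tv_norm_image_le _ (measurable_coord_pair e)).
  rewrite le_eqVlt; apply/orP; left; apply/eqP; congr tv_norm.
  apply/funext => A; congr (_ - _)%E; congr (nu n _).
  by apply/funext => z; congr (A (_, _)); apply/esym/coinduced_stabilizer.
Unshelve. all: by end_near. Qed.

Lemma rigid_coinduced_finite :
  rigid mu act -> finite_set [set: D] -> rigid eta (coinduced (D := D) act).
Proof.
move=> rigid_mu finD nu marg weak inv.
have coord e := rigid_coord e rigid_mu marg weak inv.
pose E e := coord_pair e @^-1` [set z | z.1 <> z.2].
have mE e : measurable (E e).
  apply: (measurable_preimage (measurable_coord_pair e)).
  exact: measurableC diagX.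
have nuE e : (fun n => nu n (E e)) @ \oo --> 0%E.
  have -> : (fun n => nu n (E e)) =
      (fun n => 1 - nu n (coord_pair e @^-1` [set z | z.1 = z.2]))%E.
    apply/funext => n; rewrite -probability_setC//.
    exact: measurable_preimage (measurable_coord_pair e) diagX.
  by rewrite -(@subee _ 1%E)//; apply: cvgeB => //; exact: cvg_cst.
have [s sD] := (finite_seqP _).1 finD.
have diagE : [set z : Y * Y | z.1 = z.2] = ~` \big[setU/set0]_(e <- s) E e.
  rewrite -bigcup_seq setC_bigcup; apply/seteqP; split => [[x y] /= -> e _ //|].
  move=> [x y] /= xy; apply/funext => e; apply/not_notP => xye.
  by apply: (xy e) => //; have : [set: D] e by []; rewrite sD.
have mU : measurable (\big[setU/set0]_(e <- s) E e).
  exact: bigsetU_measurable.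
rewrite diagE; under eq_fun do rewrite probability_setC//.
suff : (fun n => 1 - nu n (\big[setU/set0]_(e <- s) E e))%E @ \oo --> (1 - 0)%E.
  by rewrite sube0.
apply: cvgeB => //; first exact: cvg_cst.
apply: (@squeeze_cvge _ _ _ _ (cst 0%E) _ (fun n => \sum_(e <- s) nu n (E e))%E).
- near=> n; rewrite measure_ge0/=.
  elim: (s) => [|e t IH]; first by rewrite !big_nil measure0.
  rewrite !big_cons; apply: le_trans (measureU2 _ _ _) _ => //.
    exact: bigsetU_measurable.
  exact: leeD.
- exact: cvg_cst.
- suff : (fun n => \sum_(e <- s) nu n (E e))%E @ \oo -->
      (\sum_(e <- s) (0 : \bar R))%E by rewrite big1.
  by apply: (cvg_nnesum (f := fun e n => nu n (E e))) => // e _; near=> n.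
Unshelve. all: by end_near. Qed.

End FiniteIndex.

(** * Resampling coordinates *)

Section Mixing.
Context {R : realType} {I : choiceType} {d} {X : measurableType d}.
Context (mu : probability X R) (eta : probability (power_space I X) R).
Hypothesis product_eta : is_product_measure mu eta.
Local Notation Y := (power_space I X).

(** The first component selects the coordinates of the second one that are
    replaced by those of the third one. *)
Definition triple : probability (Y * (Y * Y))%type R :=
  (eta \x (eta \x eta : probability (Y * Y)%type R)%E)%E.

Definition mix (C : set X) (z x x' : Y) : Y :=
  fun i => if z i \in C then x' i else x i.

Definition mixed_pair (C : set X) (w : Y * (Y * Y)) : Y * Y :=
  (w.2.1, mix C w.1 w.2.1 w.2.2).

Lemma measurable_first : measurable_fun setT (fun w : Y * (Y * Y) => w.2.1).
Proof. exact: measurableT_comp. Qed.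

Lemma measurable_second : measurable_fun setT (fun w : Y * (Y * Y) => w.2.2).
Proof. exact: measurableT_comp. Qed.

Lemma measurable_mixed (C : set X) : measurable C ->
  measurable_fun setT (fun w => mix C w.1 w.2.1 w.2.2).
Proof.
move=> mC; apply: measurable_power => i.
apply: measurable_fun_ifT.
- apply: (measurable_fun_bool true); rewrite setTI.
  rewrite (_ : _ @^-1` _ = (fun w : Y * (Y * Y) => w.1 i) @^-1` C).
    apply: measurable_preimage => //.
    exact: (measurableT_comp (measurable_coord i)).
  by apply/seteqP; split => w /=; [move/set_mem|move/mem_set].
- exact: (measurableT_comp (measurable_coord i) measurable_second).
- exact: (measurableT_comp (measurable_coord i) measurable_first).
Qed.

Lemma measurable_mixed_pair (C : set X) : measurable C ->
  measurable_fun setT (mixed_pair C).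
Proof.
move=> mC; apply: measurable_fun_pair; first exact: measurable_first.
exact: measurable_mixed.
Qed.

Lemma triple_selector (A : set Y) : measurable A ->
  triple ((fun w => w.1) @^-1` A) = eta A.
Proof.
move=> mA; transitivity (triple (A `*` setT)).
  by congr (triple _); apply/seteqP; split => w /=; tauto.
rewrite -[RHS]mule1.
apply: etrans
  (product_measure1E eta (eta \x eta : probability _ R)%E mA measurableT) _.
congr (_ * _)%E; exact: probability_setT.
Qed.

Lemma triple_pair (A : set (Y * Y)) : measurable A ->
  triple ((fun w => w.2) @^-1` A) = (eta \x eta)%E A.
Proof.
move=> mA; transitivity (triple (setT `*` A)).
  by congr (triple _); apply/seteqP; split => w /=; tauto.
rewrite -[RHS]mul1e.
apply: etrans
  (product_measure1E eta (eta \x eta : probability _ R)%E measurableT mA) _.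
congr (_ * _)%E; exact: probability_setT.
Qed.

Lemma law_first (A : set Y) : measurable A ->
  triple ((fun w => w.2.1) @^-1` A) = eta A.
Proof.
move=> mA; rewrite (triple_pair (A := fst @^-1` A)); last first.
  exact: measurable_preimage.
transitivity ((eta \x eta)%E (A `*` setT)).
  by congr product_measure1; apply/seteqP; split => w /=; tauto.
rewrite product_measure1E//.
by rewrite -[RHS]mule1; congr (_ * _)%E; exact: probability_setT.
Qed.

(** For a fixed selector z, the event that the mixture of x and x' lies in a box
    is a product of a box for x and a box for x', each coordinate of the
    original box constraining exactly one of the two. *)
Lemma law_mixed (C : set X) (A : set Y) : measurable C -> measurable A ->
  triple ((fun w => mix C w.1 w.2.1 w.2.2) @^-1` A) = eta A.
Proof.
move=> mC; move: A.
apply: (power_measure_unique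
  (eta := image_prob triple (measurable_mixed mC)) _ product_eta).
move=> n i A inji mA.
pose A1 z k := if z (i k) \in C then setT else A k.
pose A2 z k := if z (i k) \in C then A k else setT.
have mA1 z k : measurable (A1 z k) by rewrite /A1; case: ifP.
have mA2 z k : measurable (A2 z k) by rewrite /A2; case: ifP.
transitivity (\int[eta]_z (\prod_(k < n) mu (A k)))%E; last first.
  rewrite integral_cst// -[RHS]mule1; congr (_ * _)%E; exact: probability_setT.
apply: eq_integral => z _ /=.
rewrite (_ : xsection _ z = box i (A1 z) `*` box i (A2 z)); last first.
  apply/seteqP; split => -[x x']; rewrite xsectionE /=.
    move=> xA; split=> k; have := xA k; rewrite /A1 /A2 /mix/=;
    by case: ifP.
  move=> [xA1 xA2] k; have := xA1 k; have := xA2 k; rewrite /A1 /A2 /mix/=.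
  by case: ifP.
rewrite product_measure1E; [|exact: measurable_box..].
transitivity ((\prod_(k < n) mu (A1 z k)) * \prod_(k < n) mu (A2 z k))%E.
  by congr (_ * _)%E; exact: product_eta.
rewrite -big_split; apply: eq_bigr => k _ /=; rewrite /A1 /A2.
have muT : mu setT = 1%E by exact: probability_setT.
by case: ifP => _; rewrite muT ?mule1 ?mul1e.
Qed.

(** The map is [f] applied to both components: it commutes with mixing once the
    selector is permuted by [p] too, and all three maps preserve [eta]. *)
Lemma mixed_pair_invariant (C : set X) (p : I -> I) (a : I -> X -> X)
    (f : Y -> Y) (B : set (Y * Y)) :
  measurable C -> injective p ->
  (forall i, measurable_fun setT (a i)) ->
  (forall i A, measurable A -> mu (a i @^-1` A) = mu A) ->
  f = (fun x i => a i (x (p i))) -> measurable B ->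
  triple (mixed_pair C @^-1` ((fun z => (f z.1, f z.2)) @^-1` B)) =
  triple (mixed_pair C @^-1` B).
Proof.
move=> mC injp ma mua -> mB.
have [mf pf] := relabel_preserves product_eta injp ma mua.
have [mu_ pu] := relabel_preserves (a := fun _ x => x) product_eta injp
  (fun=> @measurable_id _ _ _) (fun _ _ _ => erefl).
have mff := measurable_prod_map mf mf.
have pff := product_map_preserves mf mf pf pf.
apply/esym/(etrans (esym (product_map_preserves mu_ mff pu pff
  (measurable_preimage (measurable_mixed_pair mC) mB)))).
congr (triple _); apply/funext => -[z [x x']]; congr (B (_, _)).
by apply/funext => i; rewrite /mixed_pair /mix /=; case: ifP.
Qed.

(** The coordinate [i] of the mixture differs from the original one only if it
    is resampled, which has probability [mu C]. The index 0 is a dummy, for the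
    sequence of mixtures considered here is constant. *)
Lemma mixed_discrepancy_coord (C A : set X) (i : I) :
  measurable C -> measurable A ->
  (triple (discrepancy (fun w : Y * (Y * Y) => w.2.1)
     (fun=> fun w => mix C w.1 w.2.1 w.2.2) [set y | A (y i)] 0) <= mu C)%E.
Proof.
move=> mC mA; have mi := measurable_preimage (measurable_coord i) mC.
rewrite -[leRHS](etrans (triple_selector mi)
  (product_measure_coord i product_eta mC)).
apply: le_measure; rewrite ?inE.
- apply: measurable_discrepancy => //; first exact: measurable_first.
    by move=> _; exact: measurable_mixed.
  exact: measurable_preimage (measurable_coord i) mA.
- exact: measurable_preimage (@measurable_fst _ _ _ _) mi.
- move=> w; rewrite /discrepancy /mix /=.
  case: ifP => [/set_mem//|_]; tauto.
Qed.

Hypothesis atom_free : forall x, mu [set x] = 0%E.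
Hypothesis diagX : measurable [set z : X * X | z.1 = z.2].

Lemma coincidence_null (i : I) :
  triple [set w | w.2.1 i = w.2.2 i] = 0%E.
Proof.
have mD : measurable [set z : Y * Y | z.1 i = z.2 i].
  apply: (measurable_preimage (f := fun z : Y * Y => (z.1 i, z.2 i)) _ diagX).
  by apply: measurable_fun_pair; apply: (measurableT_comp (measurable_coord i)).
rewrite (triple_pair mD); apply: integral0_eq => x _ /=.
rewrite -(atom_free (x i)).
rewrite -(product_measure_coord i product_eta (set1_measurable (x i) diagX)).
by congr (eta _); apply/seteqP; split => y; rewrite xsectionE.
Qed.

(** If the mixture equals x, then every coordinate in [s] is either kept, that
    is its selector avoids [C], or resampled to the same value, which is a null
    event. *)
Lemma mixed_diagonal_le (C : set X) (s : seq I) :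
  countable [set: I] -> measurable C -> uniq s ->
  (triple (mixed_pair C @^-1` [set z | z.1 = z.2]) <=
   \prod_(k < size s) mu (~` C))%E.
Proof.
move=> cI mC us.
pose A : set Y := box (tnth (in_tuple s)) (fun=> ~` C).
have mA : measurable A by apply: measurable_box => _; exact: measurableC.
pose E i : set (Y * (Y * Y)) := [set w | w.2.1 i = w.2.2 i].
have mE i : measurable (E i).
  apply: (measurable_preimage
    (f := fun w : Y * (Y * Y) => (w.2.1 i, w.2.2 i)) _ diagX).
  by apply: measurable_fun_pair;
    [exact: (measurableT_comp (measurable_coord i) measurable_first)
    |exact: (measurableT_comp (measurable_coord i) measurable_second)].
have E0 i : (triple (E i) <= 0)%E by rewrite [leLHS]coincidence_null.
have mU : measurable (\big[setU/set0]_(i <- s) E i) by exact: bigsetU_measurable.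
have U0 : triple (\big[setU/set0]_(i <- s) E i) = 0%E.
  apply/eqP; rewrite -measure_le0; elim: (s) => [|i t IH].
    by rewrite big_nil measure0.
  rewrite big_cons; apply: le_trans (measureU2 _ (mE i) _) _.
    exact: bigsetU_measurable.
  by rewrite -(adde0 0%E); apply: leeD; [exact: E0|exact: IH].
have -> : (\prod_(k < size s) mu (~` C))%E = triple ((fun w => w.1) @^-1` A).
  rewrite triple_selector//; apply/esym/product_eta.
    exact/tuple_uniqP.
  by move=> _; exact: measurableC.
rewrite -[leRHS]adde0 -U0.
have m1 : measurable ((fun w : Y * (Y * Y) => w.1) @^-1` A).
  exact: measurable_preimage (@measurable_fst _ _ _ _) mA.
apply: le_trans (measureU2 _ m1 mU); apply: le_measure; rewrite ?inE.
- apply: measurable_preimage (measurable_mixed_pair mC) _.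
  exact: diag_power_measurable.
- exact: measurableU.
move=> w /= wE; have [wC|/existsNP[k /contrapT wk]] :=
  pselect (forall k, (~` C) (w.1 (tnth (in_tuple s) k))); first by left.
right; rewrite -bigcup_seq; exists (tnth (in_tuple s) k).
  exact: mem_tnth.
have := congr1 (fun y : Y => y (tnth (in_tuple s) k)) wE.
by rewrite /E /mix /= mem_set.
Qed.

Lemma mixed_diagonal_le_half (C : set X) :
  infinite_set [set: I] -> countable [set: I] -> measurable C ->
  (0 < mu C)%E ->
  (triple (mixed_pair C @^-1` [set z | z.1 = z.2]) <= (2^-1)%:E)%E.
Proof.
move=> iI cI mC C0.
set q := fine (mu (~` C)).
have qE : mu (~` C) = q%:E.
  by rewrite fineK// fin_num_measure//; exact: measurableC.
have [q0 q1] : 0 <= q /\ q < 1.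
  rewrite -lee_fin -lte_fin -qE measure_ge0; split=> //.
  rewrite probability_setC//.
  have mCf := fin_num_measure mu _ mC.
  by move: C0; rewrite -(fineK mCf) lte_fin -EFinB lte_fin => C0; lra.
have /cvg_expr/cvgrPdist_le/(_ 2^-1) : `|q| < 1 by rewrite ger0_norm.
rewrite invr_gt0 ltr0n => /(_ isT)[N _ /(_ N (leqnn N))].
rewrite sub0r normrN ger0_norm ?exprn_ge0// => qN.
have [F _ NF] := infinite_set_fset N iI.
have sz : size (take N (finmap.enum_fset F)) = N by rewrite size_takel.
have us : uniq (take N (finmap.enum_fset F)).
  by rewrite take_uniq ?finmap.fset_uniq.
apply: le_trans (mixed_diagonal_le cI mC us) _; rewrite sz qE.
rewrite (_ : (\prod_(k < N) q%:E)%E = (q ^+ N)%:E) ?lee_fin//.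
elim: (N) => [|m IH]; first by rewrite big_ord0.
by rewrite big_ord_recr/= IH -EFinM exprSr.
Qed.

End Mixing.

(** * Infinite index prevents rigidity *)

Section InfiniteIndex.
Context {R : realType} {G : groupType} {S : pred G} {G0 : subGroupType S}.
Context {d} {X : measurableType d} (mu : probability X R) (act : G0 -> X -> X).
Context {D : set G} (fundamental_D : fundamental_domain G0 D).
Context (eta : probability (power_space D X) R).
Hypothesis pmp_act : pmp_action mu act.
Hypothesis product_eta : is_product_measure mu eta.
Hypothesis diagX : measurable [set z : X * X | z.1 = z.2].
Hypothesis atomless_mu : atomless mu.
Hypothesis countable_D : countable [set: D].
Hypothesis infinite_D : infinite_set [set: D].
Local Notation Y := (power_space D X).
Local Notation P := (triple eta).

(** The three conditions on the laws of the pairs (x, y_n) are exact marginals,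
    exact invariance, and this convergence. *)
Lemma mixed_integral_cvg (C : nat -> set X) (phi psi : Y -> R) :
  (forall n, measurable (C n)) ->
  (forall n, mu (C n) <= (2^-1 ^+ n)%:E)%E ->
  bounded_measurable phi -> bounded_measurable psi ->
  (fun n => \int[P]_w (phi w.2.1 * psi (mix (C n) w.1 w.2.1 w.2.2)))%R
    @ \oo --> (\int[P]_w (phi w.2.1 * psi w.2.1))%R.
Proof.
move=> mC Csmall bphi bpsi.
have mfirst : measurable_fun setT (fun w : Y * (Y * Y) => w.2.1).
  exact: measurable_first.
have mmix n := measurable_mixed (I := D) (mC n).
apply: (cvg_integral_of_discrepancy mfirst mmix _ bphi bpsi).
apply: (vanishing_discrepancy mfirst mmix (G := coordinate_sets D X) erefl).
- move=> n B mB; apply: etrans (law_mixed product_eta (mC n) mB) _.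
  exact: esym (law_first eta mB).
- move=> _ [i [A [mA ->]]] e e0.
  have /cvg_expr/cvgrPdist_le/(_ e e0) : `|2^-1 : R| < 1.
    by rewrite ger0_norm ?invr_ge0//; lra.
  apply: filterS => n; rewrite sub0r normrN ger0_norm ?exprn_ge0 ?invr_ge0// => ne.
  apply: le_trans (mixed_discrepancy_coord product_eta i (mC n) mA) _.
  by apply: le_trans (Csmall n) _; rewrite lee_fin.
Qed.

Lemma not_rigid_coinduced_infinite : ~ rigid eta (coinduced (D := D) act).
Proof.
move=> rigid_eta.
have [C HC] := choice (atomless_small atomless_mu).
have mC n : measurable (C n) by have [] := HC n.
have Csmall n : (mu (C n) <= (2^-1 ^+ n)%:E)%E by have [] := HC n.
have mfirst : measurable_fun setT (fun w : Y * (Y * Y) => w.2.1).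
  exact: measurable_first.
have mmix n := measurable_mixed (I := D) (mC n).
pose nu n : probability (Y * Y)%type R :=
  image_prob P (measurable_mixed_pair (mC n)).
have [_ _ mact act_mu] := pmp_act.
suff nu1 : (fun n => nu n [set z | z.1 = z.2]) @ \oo --> 1%E.
  suff : (1 <= (2^-1 : R)%:E)%E by rewrite lee_fin; lra.
  apply: cvge_to_le nu1 _; near=> n; have [_ C0 _] := HC n.
  apply: (mixed_diagonal_le_half product_eta) => // x.
  exact: (atomless_set1 atomless_mu (set1_measurable x diagX)).
apply: rigid_eta => [n A mA|phi psi bphi bpsi|g].
- split; first exact: (law_first eta mA).
  exact: (law_mixed product_eta (mC n) mA).
- have -> : (fun n => cintegral (nu n) (fun z => phi z.1 * psi z.2)) =
      (fun n => cintegral P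
        (fun w => phi w.2.1 * psi (mix (C n) w.1 w.2.1 w.2.2))).
    apply/funext => n; apply: cintegral_image_prob.
      exact: bounded_measurable_Re_prod.
    exact: bounded_measurable_Im_prod.
  have -> : cintegral eta (fun x => phi x * psi x) =
      cintegral P (fun w => phi w.2.1 * psi w.2.1).
    rewrite -(cintegral_image_prob P (f := fun x => phi x * psi x) mfirst);
      [|exact: bounded_measurable_Re_prod|exact: bounded_measurable_Im_prod].
    rewrite /cintegral /Rintegral; congr (fine _ +i* fine _)%C;
      by apply: eq_measure_integral => A mA _; exact: esym (law_first eta mA).
  have [Rphi Iphi] := (bounded_borel_Re bphi, bounded_borel_Im bphi).
  have [Rpsi Ipsi] := (bounded_borel_Re bpsi, bounded_borel_Im bpsi).
  apply: cvg_ReIm.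
  + rewrite (Re_cintegral_prod mfirst mfirst)//.
    under eq_fun do rewrite (Re_cintegral_prod mfirst (mmix _))//.
    by apply: cvgB; [exact: (mixed_integral_cvg mC Csmall Rphi Rpsi)
      |exact: (mixed_integral_cvg mC Csmall Iphi Ipsi)].
  + rewrite (Im_cintegral_prod mfirst mfirst)//.
    under eq_fun do rewrite (Im_cintegral_prod mfirst (mmix _))//.
    by apply: cvgD; [exact: (mixed_integral_cvg mC Csmall Rphi Ipsi)
      |exact: (mixed_integral_cvg mC Csmall Iphi Rpsi)].
- have -> : (fun n => tv_norm (fun A => pushforward (nu n)
      (fun z => (coinduced act g z.1, coinduced act g z.2)) A - nu n A)%E) =
      cst 0%E.
    apply/funext => n; apply: tv_norm_eq0 => A mA.
    suff -> : pushforward (nu n)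
        (fun z => (coinduced act g z.1, coinduced act g z.2)) A = nu n A.
      by rewrite subee// fin_num_measure.
    apply: (mixed_pair_invariant product_eta (p := dom_act G0 g^-1%g)
      (a := fun i => act (cocycle G0 g^-1%g i)^-1%g)) => //.
      exact: (dom_act_inj fundamental_D).
    by move=> i B mB; exact: act_mu.
  exact: cvg_cst.
Unshelve. all: by end_near. Qed.

End InfiniteIndex.

(** * The equivalence *)

Theorem proposition1p2 (R : realType)
    (Gamma : groupType) (S : pred Gamma) (Gamma0 : subGroupType S)
    (countable_Gamma : countable [set: Gamma])
    (dX : measure_display) (X : measurableType dX) (mu : probability X R)
    (standard_X : standard_borel (R := R) X) (atomless_mu : atomless mu)
    (act : Gamma0 -> X -> X) (pmp_act : pmp_action mu act)
    (rigid_act : rigid mu act)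
    (D : set Gamma) (fundamental_D : fundamental_domain Gamma0 D)
    (eta : probability (power_space D X) R)
    (product_eta : is_product_measure mu eta) :
  rigid eta (coinduced (D := D) act) <-> finite_index Gamma0.
Proof.
have [A [mA sepA]] := standard_borel_separated standard_X.
have diagX := diag_measurable mA sepA.
rewrite (finite_index_fundamental_domain fundamental_D); split.
  move=> rigid_eta; apply: contrapT => infinite_D.
  apply: (not_rigid_coinduced_infinite fundamental_D pmp_act product_eta diagX
    atomless_mu _ infinite_D rigid_eta).
  have [f injf] := countable_injP _ countable_Gamma.
  apply/countable_injP; exists (f \o val) => x y _ _ /= /injf xy.
  by apply/val_inj/xy; rewrite inE.
exact: (rigid_coinduced_finite fundamental_D product_eta diagX rigid_act).
Qed.
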